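(* Consider a regression model with parameter vector $\theta$ ($p\times 1$) and a single regression variable $x$, for which designs can be written as $\xi=\{(c_i,\omega_i),\ i=1,\dots,N\}$ with $c_i\in[A,B]$, and suppose that the information matrix for $\theta$ under a design $\xi$ can be written as $$I_\xi(\theta)=P(\theta)\Big(\sum_{i=1}^N\omega_i C(\theta,c_i)\Big)P(\theta)^T,\qquad C(\theta,c)=\big(\Psi_{ij}(c)\big)_{1\le i,j\le p},\quad c\in[A,B],$$ where $P(\theta)$ is a nonsingular $p\times p$ matrix depending only on $\theta$ and $C(\theta,c)$ is a symmetric $p\times p$ matrix. Let $1\le p_1<p$ and let $C_{22}(c)$ be the lower-right $p_1\times p_1$ principal submatrix of $C(\theta,c)$. Let $\Psi_0=1$ and let $\Psi_1,\dots,\Psi_{k-1}$ be a maximum set of linearly independent nonconstant functions among the entries $\Psi_{ij}$ in the first $p-p_1$ columns of $C(\theta,c)$. For a nonzero vector $Q\in\mathbb{R}^{p_1}$ let $\Psi_k^Q(c)=Q^TC_{22}(c)Q$. Suppose that one of the following two conditions holds: (I) $\{\Psi_0,\Psi_1,\dots,\Psi_{k-1}\}$ and $\{\Psi_0,\Psi_1,\dots,\Psi_{k-1},\Psi_k^Q\}$ form Chebyshev systems on $[A,B]$ for every nonzero vector $Q$; (II) $\{\Psi_0,\Psi_1,\dots,\Psi_{k-1}\}$ and $\{\Psi_0,\Psi_1,\dots,\Psi_{k-1},-\Psi_k^Q\}$ form Chebyshev systems on $[A,B]$ for every nonzero vector $Q$. Then the following complete class results hold: (a) For $k=2n-1$,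 if (I) holds, the designs with at most $n$ support points, including $B$, form a complete class. (b) For $k=2n-1$, if (II) holds, the designs with at most $n$ support points, including $A$, form a complete class. (c) For $k=2n$, if (I) holds, the designs with at most $n+1$ support points, including both $A$ and $B$, form a complete class. (d) For $k=2n$, if (II) holds, the designs with at most $n$ support points form a complete class.
   Context: Design (approximate design): a finite collection $\xi=\{(c_i,\omega_i),\ i=1,\dots,N\}$ of points $c_i\in[A,B]$ (the support points) with weights $\omega_i>0$, $\sum_{i=1}^N\omega_i=1$. The $c_i$ are obtained from the values $x_i$ of the regression variable by a bijection that may depend on $\theta$. The functions $\Psi_{ij}$ may also depend on $\theta$; the value of $\theta$ is fixed (local optimality). Loewner ordering: for symmetric matrices, $M_1\ge M_2$ means $M_1-M_2$ is positive semidefinite. Complete class: a set $\mathcal{D}$ of designs such that for every design $\xi$ there is a design $\xi^*\in\mathcal{D}$ with $I_{\xi^*}(\theta)\ge I_\xi(\theta)$ in the Loewner ordering. Chebyshev system: real-valued continuous functions $u_0,\dots,u_m$ on $[A,B]$ form a Chebyshev system on $[A,B]$ if $\det\big(u_i(z_j)\big)_{0\le i,j\le m}>0$ whenever $A\le z_0<z_1<\cdots<z_m\le B$.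
   Formalization: ''At most n support points, including B'' (likewise A, or both) is read as: the support lies in a set of at most n points containing that endpoint, which may carry zero weight; with positive weight required there, the claim fails, e.g. for the one-point design at A in (c). *)

(* Defs.v *)
From HB Require Import structures.
From mathcomp Require Import all_boot all_order all_algebra.
From mathcomp Require Import all_classical all_reals all_analysis.

Set Implicit Arguments.
Unset Strict Implicit.
Unset Printing Implicit Defensive.

Import Order.TTheory GRing.Theory Num.Theory.
Import numFieldNormedType.Exports.

Local Open Scope classical_set_scope.
Local Open Scope ring_scope.

(* The number of support points is dsize; positivity of the weights and their
   sum being 1 force 0 < dsize. *)
Record design (R : realType) (A B : R) := Design {
  dsize : nat;
  dpoint : 'I_dsize -> R;
  dweight : 'I_dsize -> R;
  dpoint_inj : injective dpoint;
  dpoint_itv : forall i, dpoint i \in `[A, B];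
  dweight_gt0 : forall i, 0 < dweight i;
  dweight_sum : \sum_i dweight i = 1 }.

Arguments dpoint {R A B} _ _.
Arguments dweight {R A B} _ _.

Definition psd (R : realType) (p : nat) (M : 'M[R]_p) : Prop :=
  M^T = M /\ forall v : 'cV[R]_p, 0 <= (v^T *m M *m v) 0 0.

Definition loewner_ge (R : realType) (p : nat) (M1 M2 : 'M[R]_p) : Prop :=
  psd (M1 - M2).

Definition complete_class (R : realType) (A B : R) (p : nat)
    (info : design A B -> 'M[R]_p) (D : set (design A B)) : Prop :=
  forall xi, exists2 xi', D xi' & loewner_ge (info xi') (info xi).

(* The designs with at most n support points, including the points of E.
   The n points are a set S of allowed support points containing E, and a point
   of S may carry no mass.  Requiring positive mass at the points of E instead
   would make the complete class results false: in simple linear regression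
   with c in [A, B], where C(c) = ((1, c), (c, c^2)), a design xi' with
   I_xi' >= I_xi has the same mean as xi, so the one-point design at A is
   dominated only by itself and by no design with mass at B. *)
Definition designs_at_most (R : realType) (A B : R) (n : nat) (E : seq R) :
    set (design A B) :=
  [set xi | exists S : seq R, [/\ (size S <= n)%N, {subset E <= S} &
    forall i, dpoint xi i \in S]].

(* Families u : nat -> R -> R are used through u 0, ..., u m.-1 only, and
   functions through their values on [A, B] only. *)

Definition chebyshev_system (R : realType) (A B : R) (m : nat)
    (u : nat -> R -> R) : Prop :=
  (forall i, (i < m)%N -> {within `[A, B], continuous (u i)}) /\
  forall z : 'I_m -> R,
    (forall j, z j \in `[A, B]) ->
    (forall i j : 'I_m, (i < j)%N -> z i < z j) ->
    0 < \det (\matrix_(i < m, j < m) u i (z j)).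

Definition nonconstant_on (R : realType) (A B : R) (f : R -> R) : Prop :=
  ~ exists a : R, forall c, c \in `[A, B] -> f c = a.

Definition lin_indep_on (R : realType) (A B : R) (m : nat)
    (u : nat -> R -> R) : Prop :=
  forall a : nat -> R,
    (forall c, c \in `[A, B] -> \sum_(i < m) a i * u i c = 0) ->
    forall i, (i < m)%N -> a i = 0.

(* p = q + p1, so that the first p - p1 columns are the first q ones. *)
Definition first_columns_entry (R : realType) (A B : R) (q p1 : nat)
    (C : R -> 'M[R]_(q + p1)) (f : R -> R) : Prop :=
  exists (i : 'I_(q + p1)) (j : 'I_q),
    forall c, c \in `[A, B] -> f c = C c i (lshift p1 j).

Definition indep_entries (R : realType) (A B : R) (q p1 : nat)
    (C : R -> 'M[R]_(q + p1)) (m : nat) (u : nat -> R -> R) : Prop :=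
  [/\ forall i, (i < m)%N -> first_columns_entry A B C (u i),
      forall i, (i < m)%N -> nonconstant_on A B (u i) &
      lin_indep_on A B m u].

Definition max_indep_entries (R : realType) (A B : R) (q p1 : nat)
    (C : R -> 'M[R]_(q + p1)) (m : nat) (u : nat -> R -> R) : Prop :=
  indep_entries A B C m u /\
  forall m' u', indep_entries A B C m' u' -> (m' <= m)%N.

Definition PsiQ (R : realType) (q p1 : nat) (C : R -> 'M[R]_(q + p1))
    (Q : 'cV[R]_p1) (c : R) : R :=
  (Q^T *m drsubmx (C c) *m Q) 0 0.

Definition condition_I (R : realType) (A B : R) (q p1 : nat)
    (C : R -> 'M[R]_(q + p1)) (k : nat) (Psi : nat -> R -> R) : Prop :=
  forall Q : 'cV[R]_p1, Q != 0 ->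
    chebyshev_system A B k Psi /\
    chebyshev_system A B k.+1 [eta Psi with k |-> PsiQ C Q].

Definition condition_II (R : realType) (A B : R) (q p1 : nat)
    (C : R -> 'M[R]_(q + p1)) (k : nat) (Psi : nat -> R -> R) : Prop :=
  forall Q : 'cV[R]_p1, Q != 0 ->
    chebyshev_system A B k Psi /\
    chebyshev_system A B k.+1 [eta Psi with k |-> fun c => - PsiQ C Q c].

(* Main.v *)
(* Let sigma = 1 under (I) and sigma = -1 under (II), so that sigma Psi_k^Q extends
   the Chebyshev system Psi_0, ..., Psi_{k-1}; let E be the set of endpoints that
   the class prescribes, and m the number with k = 2 m + #E.  Fix one Q.  By
   Caratheodory and compactness, among the designs with the same
   Psi_0, ..., Psi_{k-1}-moments as xi one maximizes the integral of Psi_k^Q.  If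
   it had m + 1 support points outside E, then those points, E, and m close
   right neighbours would be k + 1 nodes, and the signed measure on the nodes that
   annihilates Psi_0, ..., Psi_{k-1} could be added to increase the integral.  So
   the maximizer lives on E and a set Y of m points.
   Such a design is optimal for every Q at once: interpolate the extension by
   Psi_0, ..., Psi_{k-1} at E, at Y and at m points close to Y; the remainder
   vanishes on the support of the maximizer and has a constant sign on the
   support of xi.  Since all entries of the first columns are combinations of
   Psi_0, ..., Psi_{k-1}, the information matrices differ only in their lower right
   blocks, where the difference is positive semidefinite by the above. *)
Require Import Defs.
From HB Require Import structures.
From mathcomp Require Import all_boot all_order all_algebra.
From mathcomp Require Import all_classical all_reals all_analysis.
From mathcomp Require Import perm zify ring lra.

Set Implicit Arguments.
Unset Strict Implicit.
Unset Printing Implicit Defensive.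

Import Order.TTheory GRing.Theory Num.Theory.
Import numFieldNormedType.Exports.

Local Open Scope classical_set_scope.
Local Open Scope ring_scope.

(** * Signs of collocation determinants and of interpolation remainders *)

Lemma increasing_perm (R : realType) (n : nat) (z : 'I_n -> R) :
  injective z ->
  exists s : {perm 'I_n}, forall i j : 'I_n, (i < j)%N -> z (s i) < z (s j).
Proof.
move=> z_inj.
pose t := [tuple z i | i < n].
have : perm_eq (sort <=%R t) t by rewrite perm_sort.
case/tuple_permP => s sortE; exists s => i j ij.
have sorted_z : sorted <%R (sort <=%R t).
  by rewrite sort_lt_sorted map_inj_uniq// enum_uniq.
have zsE (l : 'I_n) : z (s l) = nth 0 (sort <=%R t) l.
  rewrite sortE (nth_map l) ?size_enum_ord//.
  by rewrite nth_ord_enum tnth_map tnth_ord_tuple.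
by rewrite !zsE lt_sorted_ltn_nth// inE size_sort size_tuple.
Qed.

Lemma det_collocation_perm (R : realType) (n : nat) (u : nat -> R -> R)
    (z : 'I_n -> R) (s : {perm 'I_n}) :
  \det (\matrix_(i < n, j < n) u i (z (s j)))
  = (-1) ^+ s * \det (\matrix_(i < n, j < n) u i (z j)).
Proof.
have -> : \matrix_(i < n, j < n) u i (z (s j))
    = col_perm s (\matrix_(i < n, j < n) u i (z j)).
  by apply/matrixP => i j; rewrite !mxE.
by rewrite col_permE det_mulmx det_perm odd_permV mulrC.
Qed.

(* Sorting the nodes changes the determinant and the Vandermonde determinant by
   the same sign. *)
Lemma chebyshev_det_sign (R : realType) (A B : R) (n : nat)
    (u : nat -> R -> R) (z : 'I_n -> R) :
  chebyshev_system A B n u -> injective z -> (forall j, z j \in `[A, B]) ->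
  0 < \det (\matrix_(i < n, j < n) u i (z j)) *
      \prod_(i < n) \prod_(j < n | (i < j)%N) (z j - z i).
Proof.
move=> [_ u_pos] z_inj z_in.
have [s s_incr] := increasing_perm z_inj.
have vdm (y : 'I_n -> R) : \prod_(i < n) \prod_(j < n | (i < j)%N) (y j - y i)
    = \det (\matrix_(i < n, j < n) (y j) ^+ i).
  transitivity (\det (Vandermonde n (\row_j y j))).
    rewrite det_Vandermonde; apply: eq_bigr => i _; apply: eq_bigr => j _.
    by rewrite !mxE.
  by congr (\det _); apply/matrixP => i j; rewrite !mxE.
have up := u_pos (z \o s) (fun j => z_in _) s_incr.
have vp : 0 < \prod_(i < n) \prod_(j < n | (i < j)%N) (z (s j) - z (s i)).
  by apply: prodr_gt0 => i _; apply: prodr_gt0 => j ij; rewrite subr_gt0 s_incr.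
have := mulr_gt0 up vp.
rewrite (vdm (z \o s)) vdm.
rewrite (det_collocation_perm u z s).
rewrite (det_collocation_perm (fun i x => x ^+ i) z s).
by rewrite mulrACA -expr2 sqrr_sign mul1r.
Qed.

Lemma prod_ordered_pairs_recr (R : realType) (k : nat) (z : 'I_k.+1 -> R) :
  \prod_(i < k.+1) \prod_(j < k.+1 | (i < j)%N) (z j - z i)
  = (\prod_(i < k) \prod_(j < k | (i < j)%N)
       (z (widen_ord (leqnSn k) j) - z (widen_ord (leqnSn k) i)))
    * \prod_(i < k) (z ord_max - z (widen_ord (leqnSn k) i)).
Proof.
rewrite big_ord_recr/= [X in _ * X]big1 ?mulr1; last first.
  by move=> j; rewrite ltnNge -ltnS ltn_ord.
rewrite -big_split/=; apply: eq_bigr => i _.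
by rewrite big_mkcond big_ord_recr/= ltn_ord -big_mkcond.
Qed.

(* The coefficients are those of the expansion of the determinant with nodes
   [s] and [t] along its column [t]. *)
Lemma interpolation_sign (R : realType) (A B : R) (k : nat)
    (u : nat -> R -> R) (h : R -> R) (s : seq R) :
  chebyshev_system A B k u ->
  chebyshev_system A B k.+1 [eta u with k |-> h] ->
  uniq s -> size s = k -> {subset s <= `[A, B]} ->
  exists a : 'I_k -> R, let g t := h t + \sum_(i < k) a i * u i t in
    (forall t, t \in s -> g t = 0) /\
    (forall t, t \in `[A, B] -> t \notin s ->
       0 < g t * \prod_(x <- s) (t - x)).
Proof.
move=> Tu Th s_uniq s_size s_in.
pose w := [eta u with k |-> h].
(* The node [t] takes the last place, so the cofactors along its column do not depend on [t];
   divided by [D] they are the coefficients [a]. *)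
pose z t (i : 'I_k.+1) := if unlift ord_max i is Some j then nth 0 s (j : 'I_k) else t.
have liftw (j : 'I_k) : widen_ord (leqnSn k) j = lift ord_max j.
  by apply/val_inj; rewrite /= /bump leqNgt ltn_ord.
have z_max t : z t ord_max = t by rewrite /z unlift_none.
have z_lift t (j : 'I_k) : z t (lift ord_max j) = nth 0 s j by rewrite /z liftK.
pose M t : 'M[R]_k.+1 := \matrix_(i < k.+1, j < k.+1) w i (z t j).
pose D := \det (\matrix_(i < k, j < k) u i (nth 0 s j)).
have nth_in (j : 'I_k) : nth 0 s j \in s by rewrite mem_nth// s_size.
have nth_inj : injective (fun j : 'I_k => nth 0 s j).
  move=> i j /eqP; rewrite nth_uniq ?s_size// => /eqP ?; exact: val_inj.
have D_sign := chebyshev_det_sign Tu nth_inj (fun j => s_in _ (nth_in j)).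
rewrite -/D in D_sign.
have D0 : D != 0 by apply: contraTneq D_sign => ->; rewrite mul0r ltxx.
have cofE t i : cofactor (M t) i ord_max = cofactor (M 0) i ord_max :> R.
  rewrite /cofactor; congr (_ * \det _); apply/matrixP => a b.
  by rewrite !mxE !z_lift.
have cof_max : cofactor (M 0) ord_max ord_max = D.
  rewrite /cofactor -signr_odd addnn odd_double mul1r; congr (\det _).
  apply/matrixP => a b; rewrite !mxE z_lift /w /= /bump leqNgt ltn_ord add0n.
  by rewrite (ltn_eqF (ltn_ord a)).
pose a (i : 'I_k) := cofactor (M 0) (lift ord_max i) ord_max / D.
exists a => g.
have gE t : \det (M t) = g t * D.
  rewrite (expand_det_col _ ord_max) big_ord_recr/= cofE cof_max mxE z_max.
  rewrite /w/= eqxx /g mulrDl addrC; congr (_ + _).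
  rewrite mulr_suml; apply: eq_bigr => i _.
  rewrite cofE mxE z_max /= (ltn_eqF (ltn_ord i)) liftw /a.
  by rewrite [RHS]mulrAC divfK// mulrC.
split=> [t t_s|t t_in t_s].
  apply: (mulIf D0); rewrite mul0r -gE -det_tr.
  have jk : (index t s < k)%N by rewrite -s_size index_mem.
  apply: (@determinant_alternate _ _ _ ord_max (lift ord_max (Ordinal jk))).
    exact: neq_lift.
  by move=> i; rewrite !mxE z_max z_lift/= nth_index.
have z_inj : injective (z t).
  move=> i j; case: (unliftP ord_max i) => [i'|] ->;
    case: (unliftP ord_max j) => [j'|] ->; rewrite ?z_lift ?z_max//.
  - by move=> /nth_inj ->.
  - by move=> it; move: t_s; rewrite -it nth_in.
  - by move=> it; move: t_s; rewrite it nth_in.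
have z_in j : z t j \in `[A, B].
  by case: (unliftP ord_max j) => [i|] ->; rewrite ?z_lift ?z_max// s_in.
(* The determinants [g t * D] and [D] have the signs of [V * Q] and [V]. In the product of the two
   inequalities everything except [g t * Q] is a square. *)
have := mulr_gt0 (chebyshev_det_sign Th z_inj z_in) D_sign.
pose V := \prod_(i < k) \prod_(j < k | (i < j)%N) (nth 0 s j - nth 0 s i).
pose Q := \prod_(x <- s) (t - x).
have -> : \prod_(i < k.+1) \prod_(j < k.+1 | (i < j)%N) (z t j - z t i) = V * Q.
  rewrite prod_ordered_pairs_recr z_max; congr (_ * _).
    by apply: eq_bigr => i _; apply: eq_bigr => j _; rewrite !liftw !z_lift.
  rewrite /Q (big_nth 0) big_mkord s_size; apply: eq_bigr => i _.
  by rewrite liftw z_lift.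
rewrite -/(M t) gE -/V -/Q.
have -> : g t * D * (V * Q) * (D * V) = (g t * Q) * ((D * V) ^+ 2) by ring.
rewrite pmulr_lgt0// exprn_even_gt0//=; apply: lt0r_neq0; exact: D_sign.
Qed.

(** * Representations of moments by finitely many points *)

Lemma exists_linear_relation (F : fieldType) (k N : nat) (v : 'I_N -> 'I_k -> F) :
  (k < N)%N ->
  exists mu : 'I_N -> F, (exists j, mu j != 0) /\
    forall i, \sum_j mu j * v j i = 0.
Proof.
move=> kN; pose M := \matrix_(j < N, i < k) v j i.
have : kermx M != 0.
  by rewrite -mxrank_eq0 mxrank_ker -lt0n subn_gt0 (leq_ltn_trans (rank_leq_col M)).
case/rowV0Pn => mu /sub_kermxP muM mu0; exists (mu 0); split.
  by have [j ?] := rV0Pn _ mu0; exists j.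
move=> i; have /matrixP/(_ 0 i) := muM; rewrite !mxE => muMi; rewrite -[RHS]muMi.
by apply: eq_bigr => j _; rewrite !mxE.
Qed.

(** The ratio test of the simplex method: [i1] minimizes [w i / - b i] over the indices with
    [b i < 0], and the corresponding step brings the weight at [i1] to zero. *)
Lemma maximal_step (R : realFieldType) (I : finType) (w b : I -> R) (i0 : I) :
  (forall i, 0 <= w i) -> b i0 < 0 ->
  exists2 i1, b i1 < 0 & forall i, 0 <= w i + w i1 / - b i1 * b i.
Proof.
move=> w0 bi0; pose r i := w i / - b i.
case: (arg_minP r (P := fun i => b i < 0) bi0) => i1 bi1 r_min; exists i1 => // i.
have r0 : 0 <= r i1 by rewrite divr_ge0 ?oppr_ge0 ?(ltW bi1).
have [bi|bi] := ltP (b i) 0; last exact: addr_ge0 (w0 i) (mulr_ge0 r0 bi).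
have := r_min i bi; rewrite -/(r i1) {2}/r ler_pdivlMr ?oppr_gt0//.
by rewrite mulrN lerNl -subr_ge0 opprK addrC.
Qed.

Definition wsum (R : realType) (N : nat) (w x : 'I_N -> R) (F : R -> R) : R :=
  \sum_(i < N) w i * F (x i).

(* [x] and [w] are points and weights of a positive measure on [A, B] with
   moments [b]; points may coincide and weights may vanish. *)
Definition represents (R : realType) (A B : R) (k : nat) (u : nat -> R -> R)
    (b : nat -> R) (N : nat) (x w : 'I_N -> R) : Prop :=
  [/\ forall j, x j \in `[A, B], forall j, 0 <= w j &
      forall i, (i < k)%N -> wsum w x (u i) = b i].

Lemma represents_pad (R : realType) (A B : R) (k : nat) (u : nat -> R -> R)
    (b : nat -> R) (h : R -> R) (N : nat) (x w : 'I_N -> R) :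
  A <= B -> represents A B k u b x w ->
  exists x' w' : 'I_N.+1 -> R,
    represents A B k u b x' w' /\ wsum w' x' h = wsum w x h.
Proof.
move=> AB [x_in w0 wb].
exists (fun j => if unlift ord_max j is Some i then x i else A).
exists (fun j => if unlift ord_max j is Some i then w i else 0).
set x' := fun _ => _; set w' := fun _ => _.
have wsumE F : wsum w' x' F = wsum w x F.
  rewrite /wsum (bigD1_ord ord_max)//= {1}/w' unlift_none mul0r add0r.
  by apply: eq_bigr => i _; rewrite /w' /x' liftK.
split=> //; split=> [j|j|i ik]; last by rewrite wsumE wb.
- by rewrite /x'; case: unlift => //; rewrite in_itv/= lexx AB.
- by rewrite /w'; case: unlift.
Qed.

(** More than [k] points admit a linear relation between the values of the [k] functions. Its sign
    is chosen so that adding it to the weights does not decrease the integral of [h]. Since [u 0] is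
    1, its coefficients sum to zero, so one is negative and the maximal step removes a point. *)
Lemma represents_drop (R : realType) (A B : R) (k : nat) (u : nat -> R -> R)
    (b : nat -> R) (h : R -> R) (N : nat) (x w : 'I_N.+1 -> R) :
  (0 < k)%N -> (forall c, c \in `[A, B] -> u 0%N c = 1) -> (k <= N)%N ->
  represents A B k u b x w ->
  exists x' w' : 'I_N -> R,
    represents A B k u b x' w' /\ wsum w x h <= wsum w' x' h.
Proof.
move=> k0 u0 kN [x_in w0 wb].
have [mu0 [[j0 mu0j] mu0u]] :=
  exists_linear_relation (fun j (i : 'I_k) => u i (x j)) (kN : k < N.+1)%N.
have [mu [[j1 muj] muu muh]] : exists mu : 'I_N.+1 -> R,
    [/\ exists j, mu j != 0, forall i, (i < k)%N -> wsum mu x (u i) = 0 &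
        0 <= wsum mu x h].
  have mu0u' i : (i < k)%N -> wsum mu0 x (u i) = 0.
    by move=> ik; exact: (mu0u (Ordinal ik)).
  have [hp|hn] := leP 0 (wsum mu0 x h).
    by exists mu0; split=> //; exists j0.
  have wsumN F : wsum (fun j => - mu0 j) x F = - wsum mu0 x F.
    by rewrite /wsum -sumrN; apply: eq_bigr => j _; rewrite mulNr.
  exists (fun j => - mu0 j); split; first by exists j0; rewrite oppr_eq0.
    by move=> i ik; rewrite wsumN mu0u' ?oppr0.
  by rewrite wsumN oppr_ge0 ltW.
have [j2 muj2] : exists j, mu j < 0.
  have sum0 : \sum_j mu j = 0.
    rewrite -[RHS](muu _ k0); apply: eq_bigr => j _.
    by rewrite u0 ?mulr1.
  apply/existsP; apply: contraT; rewrite negb_exists => /forallP mu_ge0.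
  move: muj; rewrite (psumr_eq0P _ sum0) ?eqxx// => j _.
  by rewrite leNgt.
have [j3 muj3 step] := maximal_step w0 muj2.
set t := w j3 / - mu j3 in step.
have t0 : 0 <= t by rewrite divr_ge0 ?oppr_ge0 ?(ltW muj3).
pose w' j := w j + t * mu j.
have w'j3 : w' j3 = 0.
  by rewrite /w' /t invrN mulrN mulNr divfK ?subrr ?lt_eqF.
exists (fun j => x (lift j3 j)), (fun j => w' (lift j3 j)).
have wsumE F : wsum (fun j => w' (lift j3 j)) (fun j => x (lift j3 j)) F
    = wsum w x F + t * wsum mu x F.
  transitivity (wsum w' x F).
    by rewrite [RHS]/wsum (bigD1_ord j3)//= w'j3 mul0r add0r.
  rewrite /wsum mulr_sumr -big_split/=; apply: eq_bigr => j _.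
  by rewrite /w' mulrDl mulrA.
split; last by rewrite wsumE lerDl mulr_ge0.
by split=> // [j|i ik]; [exact: step | rewrite wsumE muu// mulr0 addr0 wb].
Qed.

(** Surplus points are dropped and missing ones are added with weight zero. The number of points
    becomes exactly [k], so that representations can be compared in a space of fixed dimension. *)
Lemma caratheodory (R : realType) (A B : R) (k : nat) (u : nat -> R -> R)
    (b : nat -> R) (h : R -> R) (N : nat) (x w : 'I_N -> R) :
  A <= B -> (0 < k)%N -> (forall c, c \in `[A, B] -> u 0%N c = 1) ->
  represents A B k u b x w ->
  exists x' w' : 'I_k -> R,
    represents A B k u b x' w' /\ wsum w x h <= wsum w' x' h.
Proof.
move=> AB k0 u0; have [Nk|kN] := leqP N k.
  have [d] := ubnP (k - N); elim: d N Nk x w => // d IH N Nk x w dN rep.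
  move: Nk; rewrite leq_eqVlt => /orP[/eqP Nk|Nk]; first by subst; exists x, w.
  have [x1 [w1 [rep1 <-]]] := represents_pad h AB rep.
  by apply: IH rep1 => //; lia.
elim: N x w kN => // N IH x w kN rep.
have [x1 [w1 [rep1 le1]]] := represents_drop h k0 u0 kN rep.
move: kN; rewrite ltnS leq_eqVlt => /orP[/eqP Nk|kN]; first by subst; exists x1, w1.
have [x2 [w2 [rep2 le2]]] := IH x1 w1 kN rep1.
by exists x2, w2; split=> //; apply: le_trans le2.
Qed.

(** * Existence of a maximal representation, and its conversion into a design *)

Lemma continuous_comp_clamp (R : realType) (A B : R) (f : R -> R) :
  A <= B -> {within `[A, B], continuous f} ->
  continuous (fun x => f (Num.max A (Num.min x B))).
Proof.
move=> AB f_cont y; pose clamp (x : R) : R := Num.max A (Num.min x B).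
have clamp_in x : `[A, B]%classic (clamp x).
  by rewrite /= in_itv/= /clamp le_max lexx/= ge_max AB ge_min lexx orbT.
have clamp_cont : {for y, continuous clamp}.
  apply: (@continuous_max R R (cst A) (fun x => Num.min x B)); first exact: cst_continuous.
  by apply: (@continuous_min R R id (cst B)); [exact: cvg_id | exact: cst_continuous].
move/subspace_continuousP : f_cont => /(_ _ (clamp_in y)).
apply: (@cvg_comp _ _ _ clamp f) => P wP.
apply: (@filterS _ (nbhs y) _
  (clamp @^-1` [set x | `[A, B]%classic x -> P x])) => [z|].
  by move=> /(_ (clamp_in z)).
exact: clamp_cont _ wP.
Qed.

(** The points range over [[A, B]] and, because [u 0] is 1, the weights over [[0, b 0]]. The moment
    equations cut a closed subset out of this compact box, on which the integral of [h] attains its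
    maximum. Clamping the points makes the integrals continuous on the whole space. *)
Lemma exists_maximal_representation (R : realType) (A B : R) (k : nat)
    (u : nat -> R -> R) (b : nat -> R) (h : R -> R) (N : nat)
    (x0 w0 : 'I_N -> R) :
  A <= B -> (0 < k)%N -> (forall c, c \in `[A, B] -> u 0%N c = 1) ->
  (forall i, (i < k)%N -> {within `[A, B], continuous (u i)}) ->
  {within `[A, B], continuous h} ->
  represents A B k u b x0 w0 ->
  exists x w : 'I_N -> R, represents A B k u b x w /\
    forall x' w' : 'I_N -> R,
      represents A B k u b x' w' -> wsum w' x' h <= wsum w x h.
Proof.
move=> AB k0 u0 u_cont h_cont rep0.
pose clamp (x : R) : R := Num.max A (Num.min x B).
have clampE x : x \in `[A, B] -> clamp x = x.
  by rewrite in_itv/= => /andP[Ax xB]; rewrite /clamp min_l// max_r.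
pose V : Type := ('rV[R]_N * 'rV[R]_N)%type.
pose J (F : R -> R) (v : V) : R := \sum_(j < N) v.2 0 j * F (clamp (v.1 0 j)).
have J_cont F : {within `[A, B], continuous F} -> continuous (J F).
  move=> F_cont v; apply: cvg_big => [|j _]; [exact: add_continuous|apply: cvgM].
    apply: (@cvg_comp _ _ _ (fun v : V => v.2) (fun y : 'rV[R]_N => y 0 j)).
      exact: cvg_snd.
    exact: coord_continuous.
  apply: (@cvg_comp _ _ _ (fun v : V => v.1 0 j) (fun y : R => F (clamp y))).
    apply: (@cvg_comp _ _ _ (fun v : V => v.1) (fun y : 'rV[R]_N => y 0 j)).
      exact: cvg_fst.
    exact: coord_continuous.
  exact: continuous_comp_clamp.
pose box : set V := [set v : 'rV[R]_N | forall j, `[A, B]%classic (v ord0 j)] `*`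
  [set v : 'rV[R]_N | forall j, `[0, b 0%N]%classic (v ord0 j)].
pose K : set V := box `&` [set v | forall i, (i < k)%N -> J (u i) v = b i].
have K_compact : compact K.
  apply: compact_closedI.
    apply: compact_setX; apply: (@rV_compact R N (fun=> _)) => j;
      exact: segment_compact.
  rewrite (_ : [set v | _] = \bigcap_(i in [set i | (i < k)%N])
    (J (u i)) @^-1` [set y | y = b i])//.
  apply: closed_bigI => i ik; apply: preimage_closed; last exact: closed_eq.
  by move=> v _; exact: J_cont (u_cont i ik) v.
have wsumE F x w : (forall j, x j \in `[A, B]) ->
    J F (\row_j x j, \row_j w j) = wsum w x F.
  by move=> x_in; apply: eq_bigr => j _; rewrite !mxE clampE.
have repK x w : represents A B k u b x w -> K (\row_j x j, \row_j w j).
  move=> [x_in w_ge0 wb]; split; last by move=> i ik; rewrite wsumE// wb.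
  split=> j /=; rewrite mxE; first exact: x_in.
  rewrite in_itv/= w_ge0/= -(wb _ k0) /wsum.
  under eq_bigr => i _ do rewrite u0// mulr1.
  by rewrite (bigD1 j)//= lerDl sumr_ge0.
have Kn0 : K !=set0 by exists (\row_j x0 j, \row_j w0 j); exact: repK.
have JhK : {within K, continuous (J h)} by exact/continuous_subspaceT/J_cont.
have [[y v]] := compact_EVT_max Kn0 K_compact JhK.
rewrite inE => -[[/= y_in v_in] yv_b] yv_max.
have yv_wsum F : J F (y, v) = wsum (v 0) (y 0) F.
  by apply: eq_bigr => j _; rewrite clampE//; exact: y_in.
exists (y 0), (v 0); split.
  split=> [j|j|i ik]; first exact: y_in; last by rewrite -yv_wsum yv_b.
  by have := v_in j; rewrite /= in_itv/= => /andP[].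
move=> x' w' rep'; rewrite -yv_wsum -wsumE; last by case: rep'.
by apply: yv_max; rewrite inE; exact: repK.
Qed.

(** Points of weight zero are discarded and coinciding points are merged with their weights added,
    as a design requires distinct points and positive weights. *)
Lemma exists_design_of_weights (R : realType) (A B : R) (N : nat)
    (x w : 'I_N -> R) :
  (forall j, x j \in `[A, B]) -> (forall j, 0 <= w j) -> \sum_j w j = 1 ->
  exists xi : design A B,
    (forall F, wsum (dweight xi) (dpoint xi) F = wsum w x F) /\
    forall i, exists2 j, 0 < w j & dpoint xi i = x j.
Proof.
move=> x_in w0 w1.
pose s := undup [seq x j | j <- enum 'I_N & 0 < w j].
pose W c := \sum_(j | x j == c) w j.
have s_uniq : uniq s by exact: undup_uniq.
have sP c : reflect (exists2 j, 0 < w j & c = x j) (c \in s).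
  rewrite mem_undup; apply: (iffP mapP) => -[j].
    by rewrite mem_filter => /andP[wj _] ->; exists j.
  by move=> wj ->; exists j => //; rewrite mem_filter wj mem_enum.
have nth_s (i : 'I_(size s)) : nth 0 s i \in s by exact: mem_nth.
have wsumE F : \sum_(i < size s) W (nth 0 s i) * F (nth 0 s i) = wsum w x F.
  transitivity (\sum_(c <- s) W c * F c); first by rewrite (big_nth 0) big_mkord.
  under eq_bigr => c _ do rewrite mulr_suml big_mkcond.
  rewrite exchange_big/=; apply: eq_bigr => j _.
  have [wj|wj] := ltP 0 (w j).
    have xjs : x j \in s by apply/sP; exists j.
    rewrite (bigD1_seq (x j))//= eqxx big1 ?addr0// => c.
    by rewrite eq_sym => /negbTE ->.
  have -> : w j = 0 by apply/eqP; rewrite eq_le wj w0.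
  by rewrite mul0r big1// => c _; rewrite mul0r if_same.
have inj : injective (fun i : 'I_(size s) => nth 0 s i).
  by move=> i j /eqP; rewrite nth_uniq// => /eqP /val_inj.
have itv (i : 'I_(size s)) : nth 0 s i \in `[A, B].
  by have /sP[j _ ->] := nth_s i.
have W0 (i : 'I_(size s)) : 0 < W (nth 0 s i).
  have /sP[j wj ->] := nth_s i.
  by rewrite /W (bigD1 j)//= ltr_pwDl// sumr_ge0.
have W1 : \sum_(i < size s) W (nth 0 s i) = 1.
  have := wsumE (fun=> 1); rewrite /wsum.
  by under eq_bigr do rewrite mulr1; under [RHS]eq_bigr do rewrite mulr1; rewrite w1.
exists (Design inj itv W0 W1); split=> [F|i]; first exact: wsumE.
by have /sP[j wj e] := nth_s i; exists j.
Qed.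

(** * Improvement of a representation by an annihilating signed measure *)

(** A signed measure on the [k.+1] nodes annihilates all [u i]; scaled to increase the integral, it
    has at [t] the sign of [sigma] times the product in the hypothesis. So it takes mass away only
    at atoms of [w], and a small multiple of it can be added. *)
Lemma improve_representation (R : realType) (A B : R) (k : nat)
    (u : nat -> R -> R) (h : R -> R) (b : nat -> R) (sigma : R) (s : seq R)
    (N : nat) (x w : 'I_N -> R) :
  chebyshev_system A B k u ->
  chebyshev_system A B k.+1 [eta u with k |-> h] ->
  sigma != 0 -> uniq s -> size s = k.+1 -> {subset s <= `[A, B]} ->
  (forall t, t \in s -> 0 < sigma * \prod_(y <- s | y != t) (t - y) \/
                        exists2 i, 0 < w i & x i = t) ->
  represents A B k u b x w ->
  exists N' (x' w' : 'I_N' -> R),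
    represents A B k u b x' w' /\ sigma * wsum w x h < sigma * wsum w' x' h.
Proof.
move=> Tu Th sigma0 s_uniq s_size s_in s_sign [x_in w0 wb].
pose z (j : 'I_k.+1) := nth 0 s j.
have z_s j : z j \in s by rewrite mem_nth// s_size.
have z_inj : injective z.
  by move=> i j /eqP; rewrite nth_uniq ?s_size// => /eqP /val_inj.
have [mu0 [[j0 mu0j0] mu0u]] :=
  exists_linear_relation (fun j (i : 'I_k) => u i (z j)) (ltnSn k).
pose d := wsum mu0 z h.
(* Interpolation at all nodes except [z j] gives a remainder that vanishes at the others; its
   integral against [mu0] is both [d] and [mu0 j] times its value at [z j]. This determines the sign
   of [mu0 j]. *)
have gamma j : exists2 c, 0 < c * \prod_(y <- s | y != z j) (z j - y) &
    mu0 j * c = d.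
  have su : uniq (rem (z j) s) by exact: rem_uniq.
  have ss : size (rem (z j) s) = k by rewrite size_rem// s_size.
  have si : {subset rem (z j) s <= `[A, B]}.
    by move=> t /mem_rem; exact: s_in.
  have [a /= [g0 gpos]] := interpolation_sign Tu Th su ss si.
  set g := fun t => h t + \sum_(i < k) a i * u i t in g0 gpos.
  exists (g (z j)).
    rewrite -big_filter -rem_filter//; apply: gpos; first exact: s_in.
    by rewrite mem_rem_uniqF.
  have -> : d = wsum mu0 z g.
    rewrite /wsum/d /wsum /g; under [RHS]eq_bigr do rewrite mulrDr mulr_sumr.
    rewrite big_split/= exchange_big/= [X in _ + X]big1 ?addr0// => i _.
    under eq_bigr do rewrite mulrCA.
    by rewrite -mulr_sumr mu0u mulr0.
  rewrite /wsum (bigD1 j)//= big1 ?addr0// => i ij.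
  rewrite [g (z i)]g0 ?mulr0// mem_rem_uniq// inE z_s andbT.
  by rewrite (inj_eq z_inj).
have d0 : d != 0.
  have [c cP <-] := gamma j0; rewrite mulf_neq0//.
  by apply: contraTneq cP => ->; rewrite mul0r ltxx.
(* Scaled so that the integral of [h] is [sigma]; adding [e] times [mu] then raises the objective by
   [e * sigma ^+ 2]. *)
pose mu j := sigma / d * mu0 j.
have muE F : wsum mu z F = sigma / d * wsum mu0 z F.
  by rewrite /wsum mulr_sumr; apply: eq_bigr => j _; rewrite mulrA.
have muu i : (i < k)%N -> wsum mu z (u i) = 0.
  by move=> ik; rewrite muE [wsum _ _ _](mu0u (Ordinal ik)) mulr0.
have muh : wsum mu z h = sigma by rewrite muE divfK.
(* Points of [x] may coincide: one index of positive weight at the node [z j] is picked to give up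
   the mass. *)
pose iota j := [pick i | (x i == z j) && (0 < w i)].
have iotaP j : mu j < 0 -> exists i, [/\ iota j = Some i, x i = z j & 0 < w i].
  move=> muj; rewrite /iota; case: pickP => [i /andP[/eqP xi wi]|no].
    by exists i.
  case: (s_sign _ (z_s j)) => [|[i wi xi]]; last first.
    by have := no i; rewrite xi eqxx wi.
  have [c cP muc] := gamma j; move=> pos.
  have mucE : mu j * c = sigma by rewrite /mu -mulrA muc divfK.
  set P := \prod_(y <- s | _) _ in cP pos.
  have : 0 < mu j * (c * P) * (c * P).
    have -> : mu j * (c * P) * (c * P) = (mu j * c * P) * (c * P) by ring.
    by rewrite mucE mulr_gt0.
  by rewrite -mulrA nmulr_rgt0// ltNge sqr_ge0.
pose v (i : 'I_N) := \sum_(j | (mu j < 0) && (iota j == Some i)) mu j.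
have vE F : wsum v x F = \sum_(j | mu j < 0) mu j * F (z j).
  rewrite /wsum /v; under eq_bigr do rewrite mulr_suml.
  rewrite (exchange_big_dep (fun j => mu j < 0))/=; last by move=> i j _ /andP[].
  apply: eq_bigr => j muj; rewrite muj/=; have [i [-> <- _]] := iotaP j muj.
  by rewrite (big_pred1 i)// => i'; rewrite (inj_eq Some_inj) eq_sym.
have v_neg i : v i < 0 -> 0 < w i.
  move=> vi; have [j /andP[muj /eqP ij]] : exists j, (mu j < 0) && (iota j == Some i).
    apply/existsP; apply: contraTT vi; rewrite negb_exists => /forallP no.
    by rewrite /v big_pred0 ?ltxx// => j; exact/negbTE/no.
  by have [i' [+ _ wi]] := iotaP j muj; rewrite ij => -[->].
have [e e0 step] : exists2 e, 0 < e & forall i, 0 <= w i + e * v i.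
  have [/existsP[i vi]|no] := boolP [exists i, v i < 0].
    have [i1 vi1 step] := maximal_step w0 vi; exists (w i1 / - v i1) => //.
    by rewrite divr_gt0 ?oppr_gt0 ?v_neg.
  exists 1 => // i; rewrite mul1r addr_ge0//.
  by move: no; rewrite negb_exists => /forallP/(_ i); rewrite -leNgt.
(* The negative part of [mu] is charged to the old points through [v], and the positive part is
   placed on the nodes as new points. *)
exists (N + k.+1)%N.
exists (fun l : 'I_(N + k.+1) => match fintype.split l with inl i => x i | inr j => z j end).
exists (fun l : 'I_(N + k.+1) => match fintype.split l with inl i => w i + e * v i
                                  | inr j => e * Num.max 0 (mu j) end).
set x' := fun l => _; set w' := fun l => _.
have wsumE F : wsum w' x' F = wsum w x F + e * wsum mu z F.
  rewrite {1}/wsum big_split_ord/=.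
  rewrite [X in X + _](_ : _ = wsum w x F + e * wsum v x F); last first.
    rewrite /wsum mulr_sumr -big_split/=; apply: eq_bigr => i _.
    by rewrite /w' /x' (unsplitK (inl i)) mulrDl mulrA.
  rewrite -addrA vE; congr (_ + _).
  rewrite [X in _ + X](_ : _ = e * \sum_(j | ~~ (mu j < 0)) mu j * F (z j)).
    by rewrite -mulrDr /wsum [in RHS](bigID (fun j => mu j < 0)).
  rewrite mulr_sumr [RHS]big_mkcond/=; apply: eq_bigr => j _.
  rewrite /w' /x' (unsplitK (inr j)) -mulrA; case: ltP => muj //=.
  by rewrite mul0r mulr0.
split; last by rewrite wsumE muh mulrDr ltrDl mulrCA mulr_gt0// -expr2 exprn_even_gt0.
split=> [l|l|i ik]; last by rewrite wsumE muu// mulr0 addr0 wb.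
  by rewrite /x'; case: splitP => j _ //; exact: s_in.
by rewrite /w'; case: splitP => j _ //; rewrite mulr_ge0 ?(ltW e0)// le_max lexx.
Qed.

(** * Separated points, prescribed endpoints and interior nodes *)

Lemma exists_lt_all (R : realFieldType) (l : seq R) :
  (forall r, r \in l -> 0 < r) ->
  exists2 d, 0 < d & forall r, r \in l -> d < r.
Proof.
elim: l => [|a l IH] l0; first by exists 1.
have [r rl|d d0 dl] := IH; first by rewrite l0// inE rl orbT.
have a0 : 0 < a by rewrite l0// mem_head.
exists (Num.min d (a / 2)); first by rewrite lt_min d0 divr_gt0.
move=> r; rewrite inE gt_min => /orP[/eqP ->|/dl ->//].
by apply/orP; right; lra.
Qed.

(** The factor 3 leaves room to move two distinct points by [d] each without making them meet. *)
Lemma exists_separation (R : realFieldType) (s : seq R) :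
  exists2 d, 0 < d & {in s &, forall x y, x != y -> 3 * d < `|x - y|}.
Proof.
have [r /allpairsP[[x y] /= [xs ys ->]]|d d0 ds] := @exists_lt_all R
    [seq if x == y then 1 else `|x - y| / 3 | x <- s, y <- s].
  by case: eqVneq => // xy; rewrite divr_gt0 ?normr_gt0 ?subr_eq0.
exists d => // x y xs ys xy.
have /ds : (if x == y then 1 else `|x - y| / 3) \in
    [seq if x == y then 1 else `|x - y| / 3 | x <- s, y <- s].
  by apply/allpairsP; exists (x, y).
by rewrite (negbTE xy) ltr_pdivlMr// mulrC.
Qed.

Lemma exists_fresh_point (R : realFieldType) (A B : R) (s : seq R) :
  A < B -> exists2 t, A < t < B & t \notin s.
Proof.
move=> AB; have [d d0 sep] := exists_separation (A :: B :: s).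
exists (A + d).
  rewrite ltrDl d0/=; have := sep A B; rewrite !inE !eqxx/= orbT => /(_ isT isT).
  rewrite lt_eqF// ltr0_norm ?subr_lt0// => /(_ isT); lra.
apply/negP => As; have := sep (A + d) A; rewrite !inE !eqxx As !orbT.
move=> /(_ isT isT); rewrite [A + d - A]addrAC subrr add0r gtr0_norm//.
by rewrite gt_eqF ?ltrDl// => /(_ isT); lra.
Qed.

(** The booleans cover the four cases at once: they also count in [k = (2 * m + eA + eB)%N], and
    [- (-1) ^+ eB] is 1 if [B] is prescribed and -1 otherwise. *)
Definition endpoints (R : realType) (A B : R) (eA eB : bool) : seq R :=
  nseq eA A ++ nseq eB B.

Lemma mem_endpoints (R : realType) (A B : R) (eA eB : bool) (t : R) :
  (t \in endpoints A B eA eB) = (eA && (t == A)) || (eB && (t == B)).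
Proof. by rewrite mem_cat !mem_nseq !lt0b. Qed.

Lemma uniq_endpoints (R : realType) (A B : R) (eA eB : bool) :
  A < B -> uniq (endpoints A B eA eB).
Proof. by case: eA; case: eB => //= AB; rewrite inE lt_eqF. Qed.

Lemma endpoints_subset (R : realType) (A B : R) (eA eB : bool) :
  A < B -> {subset endpoints A B eA eB <= `[A, B]}.
Proof.
move=> AB t; rewrite mem_endpoints in_itv/=.
by case/orP => /andP[_ /eqP ->]; rewrite lexx ltW.
Qed.

Lemma big_endpoints (R : realType) (A B : R) (eA eB : bool) (f : R -> R) :
  \prod_(y <- endpoints A B eA eB) f y
  = (if eA then f A else 1) * (if eB then f B else 1).
Proof.
rewrite big_cat; congr (_ * _).
  by case: eA; rewrite /= ?big_cons big_nil ?mulr1.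
by case: eB; rewrite /= ?big_cons big_nil ?mulr1.
Qed.

(* An endpoint that is not prescribed may itself belong to [Y]. *)
Definition interior_nodes (R : realType) (A B : R) (eA eB : bool)
    (Y : seq R) : Prop :=
  [/\ uniq Y, {subset Y <= `[A, B]} &
      forall t, t \in Y -> t \notin endpoints A B eA eB].

(** Interpolation requires exactly [m] interior nodes, while a maximizer may use fewer. The added
    points lie strictly between [A] and [B]. *)
Lemma interior_nodes_pad (R : realType) (A B : R) (eA eB : bool) (m : nat)
    (Y : seq R) :
  A < B -> interior_nodes A B eA eB Y -> (size Y <= m)%N ->
  exists Y', [/\ interior_nodes A B eA eB Y', size Y' = m & {subset Y <= Y'}].
Proof.
move=> AB; have [n] := ubnP (m - size Y); elim: n Y => // n IH Y Yn YP.
rewrite leq_eqVlt => /orP[/eqP Ym|Ym]; first by exists Y; split.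
have [t /andP[At tB] tY] := exists_fresh_point Y AB.
have [|||Y' [Y'P Y'm sub]] := IH (t :: Y); [by move=> /=; lia | | by [] |].
  case: YP => Y_uniq Y_in Y_end; split=> /= [|y|y]; first by rewrite tY.
    by rewrite inE => /orP[/eqP ->|/Y_in//]; rewrite in_itv/= !ltW.
  rewrite inE => /orP[/eqP ->|/Y_end//].
  by rewrite mem_endpoints (gt_eqF At) (lt_eqF tB) !andbF.
exists Y'; split=> // y yY; apply: sub; by rewrite inE yY orbT.
Qed.

(* Each node of [Y] becomes a double zero of an interpolating function, split
   into the simple zeros [y] and [y'] with no atom of [w] in between. *)
Lemma interior_nodes_optimal (R : realType) (A B : R) (k m : nat)
    (eA eB : bool) (u : nat -> R -> R) (h : R -> R) (b : nat -> R)
    (Y : seq R) (N N' : nat) (x w : 'I_N -> R) (x' w' : 'I_N' -> R) :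
  A < B -> k = (2 * m + eA + eB)%N ->
  chebyshev_system A B k u ->
  chebyshev_system A B k.+1 [eta u with k |-> h] ->
  interior_nodes A B eA eB Y -> (size Y <= m)%N ->
  represents A B k u b x w -> represents A B k u b x' w' ->
  (forall i, x' i \in endpoints A B eA eB ++ Y) ->
  - (-1) ^+ eB * wsum w x h <= - (-1) ^+ eB * wsum w' x' h.
Proof.
move=> AB km Tu Th YP0 Ym0 [x_in w0 wb] [x'_in w'0 w'b] x'_node0.
have {YP0 Ym0 x'_node0} [Z [ZP Zm x'_node]] : exists Z,
    [/\ interior_nodes A B eA eB Z, size Z = m &
        forall i, x' i \in endpoints A B eA eB ++ Z].
  have [Z [ZP Zm sub]] := interior_nodes_pad AB YP0 Ym0.
  exists Z; split=> // i; have := x'_node0 i; rewrite !mem_cat.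
  by case/orP => [->//|/sub ->]; rewrite orbT.
case: ZP => Z_uniq Z_in Z_end.
pose atoms := A :: B :: Z ++ codom x.
have [d d0 sep] := exists_separation atoms.
have Aatoms : A \in atoms by rewrite inE eqxx.
have Batoms : B \in atoms by rewrite !inE eqxx orbT.
have Zatoms y : y \in Z -> y \in atoms by move=> yZ; rewrite !inE mem_cat yZ !orbT.
have xatoms i : x i \in atoms by rewrite !inE mem_cat codom_f !orbT.
(* The second zero lies to the right of [y], except for [y = B], where it must lie to the left to
   stay in the interval. *)
pose tw y : R := if y < B then y + d else y - d.
have tw_dist y : `|tw y - y| = d.
  by rewrite /tw; case: ifP => _; rewrite addrC addKr ?normrN gtr0_norm.
have tw_atoms y : y \in Z -> tw y \notin atoms.
  move=> yZ; apply/negP => twy; have := sep _ _ twy (Zatoms y yZ).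
  rewrite tw_dist -subr_eq0 -normr_eq0 tw_dist gt_eqF// => /(_ isT); lra.
have tw_in y : y \in Z -> tw y \in `[A, B].
  move=> yZ; have := Z_in y yZ; rewrite !in_itv/= => /andP[Ay yB]; rewrite /tw.
  have [yltB|Bley] := ltP y B.
    have := sep _ _ (Zatoms y yZ) Batoms; rewrite lt_eqF// ltr0_norm ?subr_lt0//.
    by move=> /(_ isT) ?; apply/andP; split; lra.
  have := sep _ _ Aatoms Batoms; rewrite lt_eqF// ltr0_norm ?subr_lt0//.
  by move=> /(_ isT) ?; apply/andP; split; lra.
have tw_inj : {in Z &, injective tw}.
  move=> y1 y2 y1Z y2Z e; apply/eqP; apply: contraT => ne.
  have := sep _ _ (Zatoms _ y1Z) (Zatoms _ y2Z) ne.
  have -> : y1 - y2 = (tw y2 - y2) - (tw y1 - y1) by rewrite e; ring.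
  have := ler_normB (tw y2 - y2) (tw y1 - y1); rewrite !tw_dist; lra.
pose s := endpoints A B eA eB ++ Z ++ map tw Z.
have mem_s t : (t \in s) = [|| t \in endpoints A B eA eB, t \in Z | t \in map tw Z].
  by rewrite mem_cat; congr (_ || _); exact: mem_cat.
have s_size : size s = k by rewrite !size_cat size_map !size_nseq Zm km; lia.
have s_in : {subset s <= `[A, B]}.
  move=> t; rewrite mem_s => /or3P[|/Z_in//|/mapP[y yZ ->]].
    exact: endpoints_subset.
  exact: tw_in.
have end_atoms t : t \in endpoints A B eA eB -> t \in atoms.
  by rewrite mem_endpoints => /orP[] /andP[_ /eqP ->].
have s_uniq : uniq s.
  rewrite cat_uniq uniq_endpoints// cat_uniq Z_uniq map_inj_in_uniq// Z_uniq/= andbT.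
  apply/andP; split.
    apply/hasPn => t; rewrite mem_cat => /orP[/Z_end//|/mapP[y yZ ->]].
    by apply: contra (tw_atoms y yZ); exact: end_atoms.
  apply/hasPn => _ /mapP[y yZ ->]; apply: contra (tw_atoms y yZ); exact: Zatoms.
have [a /= [g0 gpos]] := interpolation_sign Tu Th s_uniq s_size s_in.
pose g t := h t + \sum_(i < k) a i * u i t.
(* At an atom off the nodes each pair [y], [tw y] contributes a positive factor and [A] does too;
   only the factor of a prescribed [B] is negative. *)
have g_sign i : - (-1) ^+ eB * g (x i) <= 0.
  have [xis|xis] := boolP (x i \in s); first by rewrite [g _]g0// mulr0.
  have := gpos _ (x_in i) xis; rewrite -/(g (x i)).
  move: xis; rewrite mem_s !negb_or => /and3P[xi_end xi_Z _].
  rewrite big_cat/= big_endpoints big_cat/= big_map -big_split/=.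
  set P := \prod_(y <- Z) _.
  have P0 : 0 < P.
    rewrite /P big_seq; apply: prodr_gt0 => y yZ.
    have xy : x i != y by apply: contraNneq xi_Z => ->.
    have := sep _ _ (xatoms i) (Zatoms y yZ) xy.
    have := tw_dist y; rewrite /tw.
    by case: ifP => _ _; case: (ltrgtP (x i) y) xy => // ? _;
      rewrite ?ltr0_norm ?gtr0_norm ?subr_lt0 ?subr_gt0// => ?; nra.
  move: xi_end; rewrite mem_endpoints negb_or !negb_and => /andP[xA xB].
  have := x_in i; rewrite in_itv/= => /andP[Ax xB'].
  have pA : 0 < (if eA then x i - A else 1).
    by case: (eA) xA => //= xA; rewrite subr_gt0 lt_neqAle eq_sym xA.
  rewrite !mulrA pmulr_lgt0// mulrAC pmulr_lgt0//.
  case: (eB) xB => /= xB; last first.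
    by rewrite mulr1 expr0 mulN1r oppr_le0; exact: ltW.
  have xltB : x i - B < 0 by rewrite subr_lt0 lt_neqAle xB.
  by rewrite expr1 opprK mul1r nmulr_lgt0//; exact: ltW.
(* The integrals of [g] and [h] differ by a constant common to all representations of [b]. *)
have wsumg n (y v : 'I_n -> R) : (forall i, (i < k)%N -> wsum v y (u i) = b i) ->
    wsum v y g = wsum v y h + \sum_(i < k) a i * b i.
  move=> vb; rewrite /wsum /g; under eq_bigr do rewrite mulrDr mulr_sumr.
  rewrite big_split exchange_big/=; congr (_ + _); apply: eq_bigr => i _.
  under eq_bigr do rewrite mulrCA.
  by rewrite -mulr_sumr -(vb i).
have g'0 : wsum w' x' g = 0.
  rewrite /wsum big1// => i _; rewrite [g _]g0 ?mulr0//.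
  by rewrite mem_s; have := x'_node i; rewrite mem_cat orbA => ->.
have : - (-1) ^+ eB * wsum w x g <= 0.
  rewrite /wsum mulr_sumr; apply: sumr_le0 => i _.
  by rewrite mulrCA mulr_ge0_le0.
move: g'0; rewrite !wsumg// => /eqP; rewrite addr_eq0 => /eqP ->.
by rewrite mulrDr -lerBrDr sub0r mulrN.
Qed.

(* The nodes are the endpoints, the largest point of [Y], and the pairs [y],
   [y + d] for the other points of [Y]: mass is added at the endpoints and at
   the points [y + d]. *)
Lemma improve_too_many_interior_nodes (R : realType) (A B : R) (k m : nat)
    (eA eB : bool) (u : nat -> R -> R) (h : R -> R) (b : nat -> R)
    (Y : seq R) (N : nat) (x w : 'I_N -> R) :
  A < B -> k = (2 * m + eA + eB)%N ->
  chebyshev_system A B k u ->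
  chebyshev_system A B k.+1 [eta u with k |-> h] ->
  interior_nodes A B eA eB Y -> size Y = m.+1 ->
  (forall y, y \in Y -> exists2 i, 0 < w i & x i = y) ->
  represents A B k u b x w ->
  exists N' (x' w' : 'I_N' -> R), represents A B k u b x' w' /\
    - (-1) ^+ eB * wsum w x h < - (-1) ^+ eB * wsum w' x' h.
Proof.
move=> AB km Tu Th [Y_uniq Y_in Y_end] Ym Y_supp rep.
have [yl [Z [Y_perm Z_lt]]] : exists yl Z, perm_eq Y (yl :: Z) /\
    forall y, y \in Z -> y < yl.
  case: (arg_maxP (fun i : 'I_m.+1 => Y`_i) (isT : xpredT ord0)) => i0 _ i0_max.
  have Yi0 : Y`_i0 \in Y by rewrite mem_nth// Ym.
  exists Y`_i0, (rem Y`_i0 Y); split; first exact: perm_to_rem.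
  move=> y; rewrite mem_rem_uniq// inE => /andP[yi0 yY].
  rewrite lt_neqAle yi0/= -(nth_index 0 yY).
  have iY : (index y Y < m.+1)%N by rewrite -Ym index_mem.
  exact: (i0_max (Ordinal iY)).
have YE t : (t \in Y) = (t == yl) || (t \in Z) by rewrite (perm_mem Y_perm).
have /= /andP[yl_Z Z_uniq] : uniq (yl :: Z) by rewrite -(perm_uniq Y_perm).
have Zm : size Z = m by have := perm_size Y_perm; rewrite Ym => -[].
have ylY : yl \in Y by rewrite YE eqxx.
have ZY y : y \in Z -> y \in Y by rewrite YE => ->; rewrite orbT.
have inAB y : y \in Y -> A <= y <= B by move/Y_in; rewrite in_itv.
pose atoms := A :: B :: Y.
have [d d0 sep] := exists_separation atoms.
have Aatoms : A \in atoms by rewrite inE eqxx.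
have Batoms : B \in atoms by rewrite !inE eqxx orbT.
have Yatoms y : y \in Y -> y \in atoms by move=> yY; rewrite !inE yY !orbT.
have shift_atoms y : y \in Z -> y + d \notin atoms.
  move=> /ZY yY; apply/negP => yd; have := sep _ _ yd (Yatoms y yY).
  rewrite [y + d - y]addrAC subrr add0r gtr0_norm// gt_eqF ?ltrDl// => /(_ isT).
  lra.
have shift_lt y : y \in Z -> y + d < yl.
  move=> yZ; have := sep _ _ (Yatoms y (ZY y yZ)) (Yatoms _ ylY).
  by have := Z_lt y yZ => ?; rewrite lt_eqF// ltr0_norm ?subr_lt0// => /(_ isT); lra.
have shift_in y : y \in Z -> y + d \in `[A, B].
  move=> yZ; rewrite in_itv/=; have := shift_lt y yZ.
  have := inAB _ (ZY y yZ); have := inAB _ ylY.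
  by move=> /andP[? ?] /andP[? ?] ?; apply/andP; split; lra.
pose s := endpoints A B eA eB ++ Y ++ map (+%R^~ d) Z.
have mem_s t : (t \in s) =
    [|| t \in endpoints A B eA eB, t \in Y | t \in map (+%R^~ d) Z].
  by rewrite mem_cat; congr (_ || _); exact: mem_cat.
have s_size : size s = k.+1 by rewrite !size_cat size_map !size_nseq Ym Zm km; lia.
have s_in : {subset s <= `[A, B]}.
  move=> t; rewrite mem_s => /or3P[|/Y_in//|/mapP[y yZ ->]].
    exact: endpoints_subset.
  exact: shift_in.
have end_atoms t : t \in endpoints A B eA eB -> t \in atoms.
  by rewrite mem_endpoints => /orP[] /andP[_ /eqP ->].
have s_uniq : uniq s.
  rewrite cat_uniq uniq_endpoints// cat_uniq Y_uniq map_inj_uniq ?Z_uniq/= ?andbT.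
    apply/andP; split.
      apply/hasPn => t; rewrite mem_cat => /orP[/Y_end//|/mapP[y yZ ->]].
      by apply: contra (shift_atoms y yZ); exact: end_atoms.
    apply/hasPn => _ /mapP[y yZ ->]; apply: contra (shift_atoms y yZ); exact: Yatoms.
  exact: addIr.
have sigma0 : - (-1) ^+ eB != 0 :> R by rewrite oppr_eq0 signr_eq0.
apply: (improve_representation Tu Th sigma0 s_uniq s_size s_in _ rep).
move=> t ts; have [tY|tY] := boolP (t \in Y); [by right; exact: Y_supp | left].
(* The value 1 at [t] turns the filtered product into a full one, which splits along the parts of
   [s]. *)
pose f y := if y != t then t - y else 1.
have -> : \prod_(y <- s | y != t) (t - y) =
    (if eA then f A else 1) * (if eB then f B else 1) *
    (f yl * \prod_(y <- Z) (f y * f (y + d))).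
  rewrite big_mkcond/= big_cat/= big_endpoints big_cat/= big_map.
  by rewrite (perm_big _ Y_perm)/= big_cons -!mulrA -big_split.
have fY y : y \in Y -> f y = t - y.
  by move=> yY; rewrite /f; case: eqP => // yt; move: tY; rewrite -yt yY.
have yl_end : yl \notin endpoints A B eA eB by exact: Y_end.
(* A node outside [Y] is a prescribed endpoint or a shifted point. At an endpoint, [y] and [y + d]
   lie on the same side of [t], so the sign is decided by the endpoint factors and by [t - yl]. *)
move: ts; rewrite mem_s (negbTE tY)/= => /orP[t_end|/mapP[y0 y0Z /= tE]].
  have Pr : 0 < \prod_(y <- Z) (f y * f (y + d)).
    rewrite big_seq; apply: prodr_gt0 => y yZ.
    rewrite (fY _ (ZY _ yZ)) /f ifT; last first.
      by apply: contraNneq (shift_atoms y yZ) => ->; exact: end_atoms.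
    have ty : t != y by apply: contraNneq tY => ->; exact: ZY.
    have := sep _ _ (end_atoms _ t_end) (Yatoms _ (ZY _ yZ)) ty.
    by case: (ltrgtP t y) ty => // ? _;
      rewrite ?ltr0_norm ?gtr0_norm ?subr_lt0 ?subr_gt0// => ?; nra.
  rewrite !mulrA pmulr_lgt0// (fY _ ylY).
  move: t_end yl_end; rewrite !mem_endpoints negb_or !negb_and.
  have := inAB _ ylY => /andP[Ayl ylB].
  case/orP => /andP[e /eqP te] /andP[]; rewrite e /=.
    move=> ylA _; have {}Ayl : A < yl by rewrite lt_neqAle eq_sym ylA.
    rewrite {1}/f te eqxx /=; case: (eB) => /=; rewrite ?expr1 ?expr0 !mulr1.
      rewrite opprK mul1r nmulr_rgt0 ?subr_lt0//.
      by rewrite /f te gt_eqF// subr_lt0.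
    by rewrite mulN1r oppr_gt0 subr_lt0.
  move=> _ ylB'; have {}ylB : yl < B by rewrite lt_neqAle ylB'.
  rewrite [f B]/f te eqxx /= expr1 opprK mul1r mulr1.
  case: (eA) => /=; rewrite ?mul1r ?subr_gt0//.
  by rewrite /f te lt_eqF//= mulr_gt0 ?subr_gt0.
have := shift_atoms _ y0Z; rewrite -tE !inE !negb_or.
move=> /and3P[tA tB _]; have := shift_in _ y0Z; rewrite -tE in_itv/= => /andP[At tleB].
have {}At : A < t by rewrite lt_neqAle eq_sym tA.
have {}tleB : t < B by rewrite lt_neqAle tB.
(* At [t = y0 + d] the pair of [y0] contributes [d * 1], and every other pair lies on one side of
   [t]. The negative factor [t - yl] then offsets the sign of [- (-1) ^+ eB] times the factor of
   [B]. *)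
have Pr : 0 < \prod_(y <- Z) (f y * f (y + d)).
  rewrite big_seq; apply: prodr_gt0 => y yZ.
  rewrite (fY _ (ZY _ yZ)) /f tE (inj_eq (addIr d)).
  have [->|ne] := eqVneq y y0; first by rewrite mulr1 [y0 + d]addrC addrK.
  rewrite opprD addrACA subrr addr0.
  have := sep _ _ (Yatoms _ (ZY _ yZ)) (Yatoms _ (ZY _ y0Z)) ne.
  case: (ltrgtP y y0) ne => // lt_y _;
    rewrite ?ltr0_norm ?gtr0_norm ?subr_lt0 ?subr_gt0// => far.
    by apply: mulr_gt0; lra.
  by rewrite nmulr_lgt0; lra.
rewrite !mulrA pmulr_lgt0// (fY _ ylY).
have tyl : t - yl < 0 by rewrite subr_lt0 tE shift_lt.
rewrite nmulr_lgt0// {1 2}/f ![_ == t]eq_sym tA tB.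
have pA : 0 < (if eA then t - A else 1) by case: (eA) => //; rewrite subr_gt0.
case: (eB) => /=; rewrite ?expr1 ?expr0 ?opprK.
  by rewrite mul1r pmulr_rlt0// subr_lt0.
by rewrite mulr1 mulN1r oppr_lt0.
Qed.

(** * Designs supported on the endpoints and [m] interior nodes *)

Lemma exists_principal_design (R : realType) (A B : R) (k m : nat)
    (eA eB : bool) (u : nat -> R -> R) (h : R -> R) (xi : design A B) :
  A < B -> (0 < k)%N -> k = (2 * m + eA + eB)%N ->
  (forall c, c \in `[A, B] -> u 0%N c = 1) ->
  chebyshev_system A B k u ->
  chebyshev_system A B k.+1 [eta u with k |-> h] ->
  exists (xi' : design A B) (Y : seq R),
    [/\ interior_nodes A B eA eB Y, (size Y <= m)%N,
        forall i, dpoint xi' i \in endpoints A B eA eB ++ Y &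
        forall i, (i < k)%N -> wsum (dweight xi') (dpoint xi') (u i)
                               = wsum (dweight xi) (dpoint xi) (u i)].
Proof.
move=> AB k0 km u0 Tu Th; pose sigma : R := - (-1) ^+ eB.
pose b i := wsum (dweight xi) (dpoint xi) (u i).
have rep0 : represents A B k u b (dpoint xi) (dweight xi).
  by split=> // i; [exact: dpoint_itv | exact/ltW/dweight_gt0].
pose H c := sigma * h c.
have wsumH N (x w : 'I_N -> R) : wsum w x H = sigma * wsum w x h.
  by rewrite /wsum mulr_sumr; apply: eq_bigr => i _; rewrite mulrCA.
have h_cont : {within `[A, B], continuous h}.
  by have := Th.1 k (ltnSn k); rewrite /= eqxx.
have H_cont : {within `[A, B], continuous H}.
  by move=> c; apply: cvgM; [exact: cvg_cst | exact: h_cont].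
have [x1 [w1 [rep1 _]]] := caratheodory H (ltW AB) k0 u0 rep0.
have [x [w [rep max]]] := exists_maximal_representation (ltW AB) k0 u0 Tu.1 H_cont rep1.
have [x_in w0 wb] := rep.
have w_sum : \sum_j w j = 1.
  rewrite -(dweight_sum xi); have := wb _ k0; rewrite /b /wsum.
  under eq_bigr do rewrite u0// mulr1.
  by under [RHS]eq_bigr do rewrite u0 ?dpoint_itv// mulr1.
have [xi' [xi'E xi'P]] := exists_design_of_weights x_in w0 w_sum.
pose X := undup (codom (dpoint xi')).
pose Y := [seq t <- X | t \notin endpoints A B eA eB].
have Y_nodes : interior_nodes A B eA eB Y.
  split=> [|t|t]; first by rewrite filter_uniq ?undup_uniq.
    rewrite mem_filter mem_undup => /andP[_ /codomP[i ->]]; exact: dpoint_itv.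
  by rewrite mem_filter => /andP[].
have [Ym|mY] := leqP (size Y) m.
  exists xi', Y; split=> // [i|i ik]; last by rewrite xi'E wb.
  rewrite mem_cat mem_filter mem_undup codom_f andbT.
  by case: (_ \in _).
exfalso; pose Z := take m.+1 Y.
have ZY t : t \in Z -> t \in Y by exact: mem_take.
have Z_nodes : interior_nodes A B eA eB Z.
  by case: Y_nodes => ? Y2 Y3; split=> [|t /ZY/Y2|t /ZY/Y3]//; exact: take_uniq.
have Z_size : size Z = m.+1 by rewrite size_takel.
have [|N' [x' [w' [rep' lt']]]] :=
  improve_too_many_interior_nodes AB km Tu Th Z_nodes Z_size _ rep.
  move=> t /ZY; rewrite mem_filter mem_undup => /andP[_ /codomP[i ->]].
  by have [j wj ->] := xi'P i; exists j.
(* The improved representation has more points than those over which [x], [w] is maximal; it is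
   brought back to [k] points before the comparison. *)
have [x2 [w2 [rep2 le2]]] := caratheodory H (ltW AB) k0 u0 rep'.
have := le_trans le2 (max _ _ rep2).
by rewrite !wsumH leNgt lt'.
Qed.

(** * From moments to the Loewner ordering of information matrices *)

(** A constant entry is a multiple of [Psi 0]. A nonconstant entry outside the span would enlarge
    the maximal independent family. *)
Lemma first_columns_entry_span (R : realType) (A B : R) (q p1 : nat)
    (C : R -> 'M[R]_(q + p1)) (k : nat) (Psi : nat -> R -> R) (f : R -> R) :
  (0 < k)%N -> (forall c, c \in `[A, B] -> Psi 0%N c = 1) ->
  max_indep_entries A B C k.-1 (fun l => Psi l.+1) ->
  first_columns_entry A B C f ->
  exists a : nat -> R,
    forall c, c \in `[A, B] -> f c = \sum_(l < k) a l * Psi l c.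
Proof.
case: k => // k _ Psi0 [[Psi_entry Psi_nc Psi_indep] Psi_max] f_entry /=.
have [[a0 fa0]|f_nc] := pselect (exists a, forall c, c \in `[A, B] -> f c = a).
  exists (fun l => if l is 0%N then a0 else 0) => c cAB.
  rewrite big_ord_recl/= Psi0// mulr1 big1 ?addr0 ?fa0// => i _.
  by rewrite mul0r.
apply: contrapT => no_span.
pose u l := if (l < k)%N then Psi l.+1 else f.
suff /Psi_max : indep_entries A B C k.+1 u by rewrite /= ltnn.
have uE (i : 'I_k) : u i = Psi i.+1 by rewrite /u ltn_ord.
have uk : u k = f by rewrite /u ltnn.
split=> [i _|i _|a a0].
- by rewrite /u; case: ifP => // /Psi_entry.
- by rewrite /u; case: ifP => // /Psi_nc.
have sumE c : c \in `[A, B] -> \sum_(i < k) a i * Psi i.+1 c + a k * f c = 0.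
  move=> cAB; rewrite -[RHS](a0 c cAB) big_ord_recr/= uk; congr (_ + _).
  by apply: eq_bigr => i _; rewrite -uE.
have [ak|ak] := eqVneq (a k) 0; last first.
  exfalso; apply: no_span.
  exists (fun l => if l is i.+1 then - a i / a k else 0) => c cAB.
  rewrite big_ord_recl/= mul0r add0r; apply: (mulfI ak).
  have /eqP := sumE c cAB; rewrite addrC addr_eq0 => /eqP ->.
  rewrite mulr_sumr -sumrN; apply: eq_bigr => i _ /=.
  by field.
move=> i; rewrite ltnS leq_eqVlt => /orP[/eqP -> //|ik].
apply: Psi_indep ik => c cAB.
by have := sumE c cAB; rewrite ak mul0r addr0.
Qed.

Lemma wsum_drsubmx_quadratic (R : realType) (q p1 N : nat)
    (C : R -> 'M[R]_(q + p1)) (w x : 'I_N -> R) (Q : 'cV[R]_p1) :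
  (Q^T *m drsubmx (\sum_i w i *: C (x i)) *m Q) 0 0 = wsum w x (PsiQ C Q).
Proof.
have -> : drsubmx (\sum_i w i *: C (x i)) = \sum_i w i *: drsubmx (C (x i)).
  by apply/matrixP => a b; rewrite !mxE !summxE; apply: eq_bigr => i _; rewrite !mxE.
rewrite mulmx_sumr mulmx_suml summxE; apply: eq_bigr => i _.
by rewrite -scalemxAr -scalemxAl mxE.
Qed.

Lemma psd_congruence (R : realType) (p : nat) (P M : 'M[R]_p) :
  psd M -> psd (P *m M *m P^T).
Proof.
case=> M_sym M_pos; split; first by rewrite !trmx_mul trmxK M_sym mulmxA.
by move=> v; have := M_pos (P^T *m v); rewrite trmx_mul trmxK !mulmxA.
Qed.

(** By symmetry the first rows vanish with the first columns, so only the lower right block enters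
    the quadratic form. *)
Lemma psd_drsubmx (R : realType) (q p1 : nat) (M : 'M[R]_(q + p1)) :
  M^T = M -> (forall i j, M i (lshift p1 j) = 0) ->
  (forall Q : 'cV[R]_p1, 0 <= (Q^T *m drsubmx M *m Q) 0 0) ->
  psd M.
Proof.
move=> M_sym M0 M_pos; split=> // v.
have -> : M = block_mx 0 0 0 (drsubmx M).
  rewrite -[LHS]submxK; congr block_mx; apply/matrixP => i j; rewrite !mxE//.
  by rewrite -M_sym mxE M0.
rewrite -[v]vsubmxK tr_col_mx mul_row_block !mulmx0 !add0r mul_row_col mul0mx add0r.
exact: M_pos.
Qed.

Lemma information_loewner_ge (R : realType) (A B : R) (q p1 k : nat)
    (C : R -> 'M[R]_(q + p1)) (Psi : nat -> R -> R) (P : 'M[R]_(q + p1))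
    (xi xi' : design A B) :
  (forall c, c \in `[A, B] -> (C c)^T = C c) ->
  (0 < k)%N -> (forall c, c \in `[A, B] -> Psi 0%N c = 1) ->
  max_indep_entries A B C k.-1 (fun l => Psi l.+1) ->
  (forall i, (i < k)%N -> wsum (dweight xi') (dpoint xi') (Psi i)
                          = wsum (dweight xi) (dpoint xi) (Psi i)) ->
  (forall Q : 'cV[R]_p1, Q != 0 ->
     wsum (dweight xi) (dpoint xi) (PsiQ C Q)
     <= wsum (dweight xi') (dpoint xi') (PsiQ C Q)) ->
  loewner_ge
    (P *m (\sum_i dweight xi' i *: C (dpoint xi' i)) *m P^T)
    (P *m (\sum_i dweight xi i *: C (dpoint xi i)) *m P^T).
Proof.
move=> C_sym k0 Psi0 Psi_max moments dom.
rewrite /loewner_ge -mulmxBl -mulmxBr; apply/psd_congruence/psd_drsubmx.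
- have sym (zeta : design A B) :
      (\sum_i dweight zeta i *: C (dpoint zeta i))^T
      = \sum_i dweight zeta i *: C (dpoint zeta i).
    rewrite linear_sum; apply: eq_bigr => i _.
    by rewrite linearZ/= C_sym ?dpoint_itv.
  by rewrite linearB/= !sym.
- move=> i j; pose f c := C c i (lshift p1 j).
  have [a fa] : exists a : nat -> R,
      forall c, c \in `[A, B] -> f c = \sum_(l < k) a l * Psi l c.
    by apply: first_columns_entry_span Psi_max _ => //; exists i, j.
  have entryE (zeta : design A B) :
      (\sum_l dweight zeta l *: C (dpoint zeta l)) i (lshift p1 j)
      = \sum_(l < k) a l * wsum (dweight zeta) (dpoint zeta) (Psi l).
    rewrite summxE; under eq_bigr => l _.
      rewrite mxE -/(f _) fa ?dpoint_itv// mulr_sumr; over.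
    rewrite exchange_big/=; apply: eq_bigr => l _; rewrite /wsum mulr_sumr.
    by apply: eq_bigr => t _; rewrite mulrCA.
  rewrite !mxE !entryE -sumrB big1// => l _.
  by rewrite moments// subrr.
move=> Q; rewrite (_ : drsubmx _ = drsubmx (\sum_i dweight xi' i *: C (dpoint xi' i))
    - drsubmx (\sum_i dweight xi i *: C (dpoint xi i))); last first.
  by apply/matrixP => i j; rewrite !mxE.
rewrite mulmxBr mulmxBl mxE [X in _ + X]mxE !wsum_drsubmx_quadratic.
have [->|Q0] := eqVneq Q 0; last by rewrite subr_ge0 dom.
have PsiQ0 c : PsiQ C 0 c = 0 by rewrite /PsiQ mulmx0 mxE.
by rewrite /wsum !big1 ?subrr// => i _; rewrite PsiQ0 mulr0.
Qed.

(** * The complete class results *)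

Lemma complete_class_endpoints (R : realType) (A B : R) (q p1 k m : nat)
    (eA eB : bool) (C : R -> 'M[R]_(q + p1)) (Psi : nat -> R -> R)
    (P : 'M[R]_(q + p1)) (info : design A B -> 'M[R]_(q + p1)) :
  A < B -> (0 < p1)%N ->
  (forall c, c \in `[A, B] -> (C c)^T = C c) ->
  (forall xi : design A B,
     info xi = P *m (\sum_i dweight xi i *: C (dpoint xi i)) *m P^T) ->
  (0 < k)%N -> (forall c, c \in `[A, B] -> Psi 0%N c = 1) ->
  max_indep_entries A B C k.-1 (fun l => Psi l.+1) ->
  k = (2 * m + eA + eB)%N ->
  (if eB then condition_I A B C k Psi else condition_II A B C k Psi) ->
  complete_class info (designs_at_most (m + eA + eB) (endpoints A B eA eB)).
Proof.
move=> AB p1_gt0 C_sym infoE k0 Psi0 Psi_max km cond xi.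
(* The sign makes [h Q] the Chebyshev extension given by the condition; multiplying its integral by
   the same sign returns that of [PsiQ C Q]. *)
pose h Q c := - (-1) ^+ eB * PsiQ C Q c.
have Tsys (Q : 'cV[R]_p1) : Q != 0 -> chebyshev_system A B k Psi /\
    chebyshev_system A B k.+1 [eta Psi with k |-> h Q].
  move=> Q0; have -> : h Q = if eB then PsiQ C Q else fun c => - PsiQ C Q c.
    by apply/funext => c; rewrite /h; case: (eB); rewrite ?expr1 ?opprK ?mul1r ?mulN1r.
  by case: (eB) cond => /(_ Q Q0).
have hE n (w x : 'I_n -> R) Q :
    - (-1) ^+ eB * wsum w x (h Q) = wsum w x (PsiQ C Q).
  rewrite /wsum mulr_sumr; apply: eq_bigr => i _.
  by rewrite /h mulrCA [X in _ * X]mulrA mulrNN -expr2 sqrr_sign mul1r.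
(* The design is constructed from this one nonzero vector, and its dominance is then proved for
   every nonzero [Q]. *)
have Q1 : const_mx 1 != 0 :> 'cV[R]_p1.
  apply/eqP => /matrixP/(_ (Ordinal p1_gt0) 0); rewrite !mxE => /eqP.
  by rewrite oner_eq0.
have [T1 Th1] := Tsys _ Q1.
have [xi' [Y [Y_nodes Ym xi'_Y moments]]] :=
  exists_principal_design xi AB k0 km Psi0 T1 Th1.
exists xi'.
  exists (endpoints A B eA eB ++ Y); split=> //.
    by rewrite !size_cat !size_nseq; lia.
  by move=> t tE; rewrite mem_cat tE.
rewrite !infoE; apply: (information_loewner_ge _ C_sym k0 Psi0 Psi_max moments).
move=> Q Q0; have [_ Th] := Tsys Q Q0.
rewrite -!hE.
apply: (interior_nodes_optimal (b := fun i => wsum (dweight xi) (dpoint xi) (Psi i))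
  AB km T1 Th Y_nodes Ym) => //.
  by split=> // i; [exact: dpoint_itv | exact/ltW/dweight_gt0].
by split=> // i; [exact: dpoint_itv | exact/ltW/dweight_gt0].
Qed.

Theorem theorem1 (R : realType) (A B : R) (hAB : A < B)
  (q p1 : nat) (hq : (0 < q)%N) (hp1 : (0 < p1)%N)
  (theta : 'cV[R]_(q + p1))
  (P : 'cV[R]_(q + p1) -> 'M[R]_(q + p1))
  (C : 'cV[R]_(q + p1) -> R -> 'M[R]_(q + p1))
  (info : design A B -> 'cV[R]_(q + p1) -> 'M[R]_(q + p1))
  (hP : P theta \in unitmx)
  (hC : forall c, c \in `[A, B] -> (C theta c)^T = C theta c)
  (hinfo : forall xi : design A B,
     info xi theta =
     P theta *m (\sum_i dweight xi i *: C theta (dpoint xi i)) *m (P theta)^T)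
  (k : nat) (hk : (0 < k)%N)
  (Psi : nat -> R -> R)
  (hPsi0 : forall c, c \in `[A, B] -> Psi 0%N c = 1)
  (hPsi : max_indep_entries A B (C theta) k.-1 (fun l => Psi l.+1))
  (hcond : condition_I A B (C theta) k Psi \/ condition_II A B (C theta) k Psi) :
  [/\ forall n : nat, k = (2 * n - 1)%N -> condition_I A B (C theta) k Psi ->
        complete_class (info ^~ theta) (designs_at_most n [:: B]),
      forall n : nat, k = (2 * n - 1)%N -> condition_II A B (C theta) k Psi ->
        complete_class (info ^~ theta) (designs_at_most n [:: A]),
      forall n : nat, k = (2 * n)%N -> condition_I A B (C theta) k Psi ->
        complete_class (info ^~ theta) (designs_at_most n.+1 [:: A; B]) &
      forall n : nat, k = (2 * n)%N -> condition_II A B (C theta) k Psi ->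
        complete_class (info ^~ theta) (designs_at_most n [::])].
Proof.
have class m eA eB := @complete_class_endpoints R A B q p1 k m eA eB (C theta) Psi
  (P theta) (info ^~ theta) hAB hp1 hC hinfo hk hPsi0 hPsi.
split=> n kn cond.
(* The number [m] of interior nodes is [n.-1] if an endpoint is prescribed and [n] otherwise;
   [0 < k] forces [0 < n], so the predecessor is not truncated. *)
- rewrite -[n](_ : n.-1 + false + true = n)%N; last by lia.
  by apply: (class _ false true) => //; lia.
- rewrite -[n](_ : n.-1 + true + false = n)%N; last by lia.
  by apply: (class _ true false) => //; lia.
- rewrite -[n.+1](_ : n.-1 + true + true = n.+1)%N; last by lia.
  by apply: (class _ true true) => //; lia.
rewrite -[n](_ : n + false + false = n)%N; last by lia.
by apply: (class _ false false) => //; lia.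
Qed.
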